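(* Let $C$ be a filtered complex of $R$-modules. There is a natural (in $C$) isomorphism of spectral sequences $E(\mathrm{Dec}(C))\to\mathrm{Dec}(E(C))$, where on the left $\mathrm{Dec}$ is Deligne's d\'ecalage of filtered complexes and on the right $\mathrm{Dec}$ is the d\'ecalage functor on spectral sequences.
   Context: $R$ is a commutative ring with unit. For $r\ge 0$, an $r$-bigraded complex is a family of $R$-modules $A=\{A^{p,n}\}_{p,n\in\mathbb Z}$ with $R$-linear maps $d_r\colon A^{p,n}\to A^{p-r,n+1-r}$, $d_r^2=0$; $H(A)=\ker d_r/\operatorname{im}d_r$. A spectral sequence $X$ is a family of $r$-bigraded complexes $(X_r,d_r)$, $r\ge0$, with isomorphisms of bigraded modules $\varphi_{r+1}\colon X_{r+1}\to H(X_r)$; morphisms are families of morphisms of $r$-bigraded complexes compatible with the $\varphi$'s. The category is $\mathrm{SpSe}$. A filtered complex is a cochain complex $(C,d)$ of $R$-modules, $d\colon C^n\to C^{n+1}$, with submodules $F_pC^n\subseteq F_{p+1}C^n\subseteq C^n$ ($p\in\mathbb Z$) such that $d(F_pC^n)\subseteq F_pC^{n+1}$; morphisms are filtration-preserving chain maps. Spectral sequence $E(C)$: for $r\ge0$, $Z_r^{p,p+n}(C)=F_pC^n\cap d^{-1}(F_{p-r}C^{n+1})$; $B_0^{p,p+n}(C)=F_{p-1}C^n$ and, for $r\ge1$, $B_r^{p,p+n}(C)=Z_{r-1}^{p-1,p+n-1}(C)+d\,Z_{r-1}^{p+r-1,p+n+r-2}(C)$; $E(C)_r^{p,p+n}=Z_r^{p,p+n}(C)/B_r^{p,p+n}(C)$,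 with $d_r$ induced by $d$ and with the canonical isomorphisms $\varphi_{r+1}\colon E(C)_{r+1}\to H(E(C)_r)$. Deligne's d\'ecalage: $\mathrm{Dec}(C)$ is the complex $C$ with filtration $F_p(\mathrm{Dec}\,C)^n=F_{p-n}C^n\cap d^{-1}(F_{p-n-1}C^{n+1})$. Translation: for an $r$-bigraded complex $A$, $(\mathcal TA)^{p,n}=A^{n,2n-p}$ with the differential of $A$; $\mathcal T$ is an isomorphism from $r$-bigraded complexes to $(r+1)$-bigraded complexes. D\'ecalage of a spectral sequence $X$: let $\mathcal N(X)_1$ be the $1$-bigraded complex with $\mathcal N(X)_1^{p,n}$ the module of $(x_0,x_1;y_0,y_1)$ with $x_i\in X_i^{p,n}$, $y_i\in X_i^{p-1,n}$, $d_0x_0=0$, $\varphi_1(x_1)=[x_0]$, $d_0y_0=0$, $\varphi_1(y_1)=[y_0]$, $d_1x_1=y_1$, and with differential $(x_0,x_1;y_0,y_1)\mapsto(y_0,y_1;0,0)$. The projection $\rho_1\colon\mathcal N(X)_1\to X_1$, $(x_0,x_1;y_0,y_1)\mapsto x_1$, is a quasi-isomorphism. Then $\mathrm{Dec}(X)_0=\mathcal T^{-1}(\mathcal N(X)_1)$, $\mathrm{Dec}(X)_i=\mathcal T^{-1}(X_{i+1})$ for $i\ge1$, with characteristic maps $\varphi_1=\mathcal T^{-1}(H(\rho_1)^{-1}\circ\varphi_2^X)$ and $\varphi_i=\mathcal T^{-1}(\varphi_{i+1}^X)$ for $i\ge2$. *)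

(* Defs.v *)
From HB Require Import structures.
From mathcomp Require Import all_boot all_order all_algebra.
From mathcomp Require Import generic_quotient ring_quotient.
From mathcomp Require Import boolp.
From mathcomp Require Import zify.

Set Implicit Arguments.
Unset Strict Implicit.
Unset Printing Implicit Defensive.

Import GRing.Theory.
Local Open Scope ring_scope.
Local Open Scope quotient_scope.

Section Submodules.
Variables (R : pzRingType) (V : lmodType R).

Definition mk_submod (S : {pred V}) (hS : submod_closed S) : submodClosed V :=
  HB.pack (S : V -> bool)
    (GRing.isSubmodClosed.Build R V (S : V -> bool)
       (GRing.submod_closed_semi hS)).

Lemma mem_mk_submod (S : {pred V}) (hS : submod_closed S) x :
  (x \in mk_submod hS) = (x \in S).
Proof. by []. Qed.

Implicit Type S : submodClosed V.

Lemma memZD S a : {in S &, forall x y, a *: x + y \in S}.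
Proof. by move=> x y xS yS; rewrite rpredD // rpredZ. Qed.

Lemma memN S : {in S, forall x, - x \in S}.
Proof. by move=> x xS; rewrite -scaleN1r rpredZ. Qed.

Lemma memB S : {in S &, forall x y, x - y \in S}.
Proof. by move=> x y xS yS; rewrite rpredD // memN. Qed.

Definition submod_sort S : Type := {x : V | x \in S}.
HB.instance Definition _ S := SubChoice.on (submod_sort S).
HB.instance Definition _ S :=
  GRing.SubChoice_isSubLmodule.Build R V _ (submod_sort S)
    (GRing.subsemimodClosedP S).

End Submodules.

Definition mk_lin (R : pzRingType) (U V : lmodType R) (f : U -> V)
    (hf : linear f) : {linear U -> V} :=
  HB.pack f (GRing.isLinear.Build R U V *:%R f hf).

Section LinearInverse.
Variables (R : pzRingType) (U V : lmodType R) (f : {linear U -> V}).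
Hypothesis bij_f : bijective f.

Lemma lin_inv_sig : {g : V -> U | cancel f g & cancel g f}.
Proof. by apply: cid2; case: bij_f => g; exists g. Qed.

Definition lin_inv : {linear V -> U} :=
  mk_lin (GRing.can2_linear (s2valP lin_inv_sig) (s2valP' lin_inv_sig)).

Lemma lin_invK : cancel f lin_inv.
Proof. exact: s2valP lin_inv_sig. Qed.

Lemma lin_invKV : cancel lin_inv f.
Proof. exact: s2valP' lin_inv_sig. Qed.

End LinearInverse.

(* The module of cosets Z / (Z ∩ B); in all uses below B is contained in Z. *)
Section Subquotient.
Variables (R : pzRingType) (V : lmodType R) (Z B : submodClosed V).

Definition subq_rel : {pred submod_sort Z} := [pred u | val u \in B].

Lemma subq_rel_closed : zmod_closed subq_rel.
Proof.
split=> [|x y]; rewrite !inE; first exact: rpred0.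
by move=> xB yB; rewrite raddfB /= memB.
Qed.

Definition subq_rel_sub : zmodClosed (submod_sort Z) :=
  HB.pack (subq_rel : submod_sort Z -> bool)
    (GRing.isZmodClosed.Build (submod_sort Z) (subq_rel : _ -> bool)
      subq_rel_closed).

Definition subq : Type := Quotient.quot subq_rel_sub.
HB.instance Definition _ := GRing.Zmodule.on subq.

Definition subq_pi (u : submod_sort Z) : subq := \pi_(Quotient.quot subq_rel_sub) u.

Lemma subq_pi_eq u v : (subq_pi u = subq_pi v) <-> (val u - val v \in B).
Proof.
split=> [/eqP|h]; last apply/eqP; rewrite /subq_pi -Quotient.idealrBE /=.
  by rewrite unfold_in.
by rewrite unfold_in.
Qed.

Lemma subq_pi_repr (q : subq) : subq_pi (repr q) = q.
Proof. exact: reprK. Qed.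

Lemma subq_piD u v : subq_pi (u + v) = subq_pi u + subq_pi v.
Proof. by rewrite /subq_pi raddfD. Qed.

Definition subq_scale a (q : subq) : subq := subq_pi (a *: repr q).

Lemma subq_scale_pi a u : subq_scale a (subq_pi u) = subq_pi (a *: u).
Proof.
apply/subq_pi_eq.
have -> : val (a *: repr (subq_pi u)) - val (a *: u)
          = a *: (val (repr (subq_pi u)) - val u) by rewrite scalerBr.
by rewrite rpredZ //; apply/subq_pi_eq; rewrite subq_pi_repr.
Qed.

Lemma subq_scaleA a b q :
  subq_scale a (subq_scale b q) = subq_scale (a * b) q.
Proof. by rewrite -(subq_pi_repr q) !subq_scale_pi scalerA. Qed.
Lemma subq_scale1 : left_id 1 subq_scale.
Proof. by move=> q; rewrite -(subq_pi_repr q) !subq_scale_pi scale1r. Qed.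
Lemma subq_scaleDr : right_distributive subq_scale +%R.
Proof.
move=> a q q'; rewrite -(subq_pi_repr q) -(subq_pi_repr q').
by rewrite -subq_piD !subq_scale_pi scalerDr subq_piD.
Qed.
Lemma subq_scaleDl q : {morph subq_scale^~ q : a b / a + b}.
Proof.
move=> a b; rewrite -(subq_pi_repr q).
by rewrite !subq_scale_pi scalerDl subq_piD.
Qed.

HB.instance Definition _ := GRing.Zmodule_isLmodule.Build R subq
  subq_scaleA subq_scale1 subq_scaleDr subq_scaleDl.

(* Total on V: the coset of x if x \in Z, and 0 otherwise. *)
Definition coset_class (x : V) : subq := subq_pi (insubd (0 : submod_sort Z) x).

Lemma coset_classE x (xZ : x \in Z) : coset_class x = subq_pi (Sub x xZ).
Proof.
by congr subq_pi; apply: val_inj; rewrite insubdK.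
Qed.

Lemma coset_class_surj (q : subq) : exists2 x, x \in Z & q = coset_class x.
Proof.
exists (val (repr q)); first exact: valP.
by rewrite /coset_class valKd subq_pi_repr.
Qed.

Lemma coset_class_eq x y : x \in Z -> y \in Z ->
  coset_class x = coset_class y <-> x - y \in B.
Proof.
move=> xZ yZ; rewrite !coset_classE.
exact: subq_pi_eq.
Qed.

Lemma coset_class_linear a x y : x \in Z -> y \in Z ->
  coset_class (a *: x + y) = a *: coset_class x + coset_class y.
Proof.
move=> xZ yZ; have aZ := memZD a xZ yZ.
rewrite !coset_classE [_ *: subq_pi _]subq_scale_pi -subq_piD.
by congr subq_pi; apply: val_inj.
Qed.

Lemma coset_class0 : coset_class 0 = 0.
Proof.
have /(@coset_class_linear 1 0 0) := rpred0 Z; move=> /(_ (rpred0 Z)).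
by rewrite !scale1r addr0 => /esym/eqP; rewrite -subr_eq0 addrK => /eqP.
Qed.

Lemma coset_class_eq0 x : x \in Z -> coset_class x = 0 <-> x \in B.
Proof.
by move=> xZ; rewrite -coset_class0 coset_class_eq ?rpred0 // subr0.
Qed.

End Subquotient.

Section SubquotientMap.
Variables (R : pzRingType) (V V' : lmodType R).
Variables (Z B : submodClosed V) (Z' B' : submodClosed V').
Variables (f : {linear V -> V'}).
Hypothesis fZ : forall x, x \in Z -> f x \in Z'.
Hypothesis fB : forall x, x \in Z -> x \in B -> f x \in B'.

Definition subq_fun (q : subq Z B) : subq Z' B' :=
  coset_class Z' B' (f (val (repr q))).

Lemma subq_funE x : x \in Z ->
  subq_fun (coset_class Z B x) = coset_class Z' B' (f x).
Proof.
move=> xZ; have rZ := valP (repr (coset_class Z B x)).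
apply: (coset_class_eq _ (fZ rZ) (fZ xZ)).2.
rewrite -linearB; apply: fB; first exact: memB.
apply: (coset_class_eq _ rZ xZ).1.
by rewrite {1}/coset_class valKd subq_pi_repr.
Qed.

Lemma subq_fun_linear : linear subq_fun.
Proof.
move=> a q q'; have [x xZ ->] := coset_class_surj q.
have [y yZ ->] := coset_class_surj q'.
by rewrite -coset_class_linear // !subq_funE ?memZD // linearP
  coset_class_linear ?fZ.
Qed.

Definition subq_map : {linear subq Z B -> subq Z' B'} := mk_lin subq_fun_linear.

Lemma subq_mapE x : x \in Z ->
  subq_map (coset_class Z B x) = coset_class Z' B' (f x).
Proof. exact: subq_funE. Qed.

Lemma subq_map_bij :
    (forall x, x \in Z -> f x \in B' -> x \in B) ->
    (forall y, y \in Z' -> exists2 x, x \in Z & y - f x \in B') ->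
  bijective subq_map.
Proof.
move=> finj fsurj.
have inj : injective subq_map.
  move=> q q'; have [x xZ ->] := coset_class_surj q.
  have [y yZ ->] := coset_class_surj q'.
  rewrite !subq_mapE // => /(coset_class_eq _ (fZ xZ) (fZ yZ)) h.
  apply/(coset_class_eq _ xZ yZ)/finj; first exact: memB.
  by rewrite linearB.
have surj q : {p | subq_map p = q}.
  apply: cid; have [y yZ ->] := coset_class_surj q.
  have [x xZ xy] := fsurj y yZ; exists (coset_class Z B x).
  rewrite subq_mapE //; apply/esym.
  exact/(coset_class_eq _ yZ (fZ xZ)).
exists (fun q => sval (surj q)) => q; last exact: svalP (surj q).
by apply: inj; exact: svalP (surj _).
Qed.

End SubquotientMap.

Section SubquotientLift.
Variables (R : pzRingType) (V W : lmodType R) (Z B : submodClosed V).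
Variable f : V -> W.
Hypothesis f_lin : forall a x y, x \in Z -> y \in Z ->
  f (a *: x + y) = a *: f x + f y.
Hypothesis fB : forall x, x \in Z -> x \in B -> f x = 0.

Definition subq_lift_fun (q : subq Z B) : W := f (val (repr q)).

Lemma subq_lift_funE x : x \in Z -> subq_lift_fun (coset_class Z B x) = f x.
Proof.
move=> xZ; have rZ := valP (repr (coset_class Z B x)).
have rB : val (repr (coset_class Z B x)) - x \in B.
  apply: (coset_class_eq _ rZ xZ).1.
  by rewrite {1}/coset_class valKd subq_pi_repr.
have := fB (memB rZ xZ) rB.
rewrite addrC -scaleN1r f_lin // scaleN1r => /eqP.
by rewrite addrC subr_eq0 => /eqP.
Qed.

Lemma subq_lift_linear : linear subq_lift_fun.
Proof.
move=> a q q'; have [x xZ ->] := coset_class_surj q.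
have [y yZ ->] := coset_class_surj q'.
by rewrite -coset_class_linear // !subq_lift_funE ?memZD // f_lin.
Qed.

Definition subq_lift : {linear subq Z B -> W} := mk_lin subq_lift_linear.

Lemma subq_liftE x : x \in Z -> subq_lift (coset_class Z B x) = f x.
Proof. exact: subq_lift_funE. Qed.

Lemma subq_lift_bij :
    (forall x, x \in Z -> f x = 0 -> x \in B) ->
    (forall w, exists2 x, x \in Z & w = f x) ->
  bijective subq_lift.
Proof.
move=> finj fsurj.
have inj : injective subq_lift.
  move=> q q' /eqP; rewrite -subr_eq0 -linearB => /eqP qq'.
  apply/eqP; rewrite -subr_eq0; apply/eqP; move: qq'.
  have [x xZ ->] := coset_class_surj (q - q').
  by rewrite subq_liftE // => fx; apply/(coset_class_eq0 _ xZ)/finj.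
have surj q : {p | subq_lift p = q}.
  apply: cid; have [x xZ ->] := fsurj q.
  by exists (coset_class Z B x); rewrite subq_liftE.
exists (fun q => sval (surj q)) => q; last exact: svalP (surj q).
by apply: inj; exact: svalP (surj _).
Qed.

End SubquotientLift.

Section Bigraded.
Variable R : comPzRingType.

(* The differential A^{p,n} -> A^{p-r,n+1-r} is given for all targets (p',n')
   together with proofs that p' = p - r and n' = n + 1 - r, so that no
   transport along equalities of indices is needed. *)
Record bicx (r : nat) := Bicx {
  bmod :> int -> int -> lmodType R;
  bd : forall p n p' n' : int, p' = p - r%:Z -> n' = n + 1 - r%:Z ->
    {linear bmod p n -> bmod p' n'};
  bdd : forall (p n p' n' p'' n'' : int)
    (ep : p' = p - r%:Z) (en : n' = n + 1 - r%:Z)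
    (ep' : p'' = p' - r%:Z) (en' : n'' = n' + 1 - r%:Z) x,
    bd ep' en' (bd ep en x) = 0
}.

Record bhom (r : nat) (A B : bicx r) := Bhom {
  bfun :> forall p n, {linear A p n -> B p n};
  bfun_d : forall (p n p' n' : int) (ep : p' = p - r%:Z) (en : n' = n + 1 - r%:Z) x,
    bfun p' n' (bd A ep en x) = bd B ep en (bfun p n x)
}.

Section Homology.
Variables (r : nat) (A : bicx r).

Lemma src_p (p : int) : p = p + r%:Z - r%:Z.
Proof. lia. Qed.

Lemma src_n (n : int) : n = n - 1 + r%:Z + 1 - r%:Z.
Proof. lia. Qed.

Section At.
Variables p n : int.

Definition bker_pred : {pred A p n} := [pred x | bd A erefl erefl x == 0].

Definition bim_pred : {pred A p n} :=
  [pred x | `[< exists y, x = bd A (src_p p) (src_n n) y >]].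

Lemma bker_closed : submod_closed bker_pred.
Proof.
split=> [|a x y]; rewrite !inE ?linear0 // => /eqP xk /eqP yk.
by rewrite linearP xk yk scaler0 addr0.
Qed.

Lemma bim_closed : submod_closed bim_pred.
Proof.
split=> [|a x y]; rewrite !inE.
  by apply/asboolP; exists 0; rewrite linear0.
move=> /asboolP [x' ->] /asboolP [y' ->]; apply/asboolP.
by exists (a *: x' + y'); rewrite linearP.
Qed.

Definition bker : submodClosed (A p n) := mk_submod bker_closed.
Definition bim : submodClosed (A p n) := mk_submod bim_closed.

Definition homology : lmodType R := subq bker bim.

(* The class in H(A)^{p,n} of a cycle x. *)
Definition hclass (x : A p n) : homology := coset_class bker bim x.

Lemma bkerP (p' n' : int) (ep : p' = p - r%:Z) (en : n' = n + 1 - r%:Z) x :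
  x \in bker <-> bd A ep en x = 0.
Proof.
rewrite mem_mk_submod inE; move: ep en => ep en; subst p' n'.
by split=> [/eqP|->].
Qed.

Lemma bimP x : x \in bim <-> exists p' n' (ep : p = p' - r%:Z)
  (en : n = n' + 1 - r%:Z) (y : A p' n'), x = bd A ep en y.
Proof.
rewrite mem_mk_submod inE; split=> [/asboolP [y ->]|].
  by exists (p + r%:Z), (n - 1 + r%:Z), (src_p p), (src_n n), y.
case=> p' [n' [ep [en [y ->]]]]; apply/asboolP.
have e1 : p' = p + r%:Z by lia.
have e2 : n' = n - 1 + r%:Z by lia.
subst p' n'; exists y.
by rewrite (eq_irrelevance ep (src_p p)) (eq_irrelevance en (src_n n)).
Qed.

Lemma bim_sub_bker x : x \in bim -> x \in bker.
Proof.
by case/bimP=> p' [n' [ep [en [y ->]]]]; apply/(bkerP erefl erefl)/bdd.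
Qed.

End At.
End Homology.

Section HomologyMap.
Variables (r : nat) (A B : bicx r) (f : bhom A B) (p n : int).

Lemma bfun_ker x : x \in bker A p n -> f p n x \in bker B p n.
Proof.
move=> /(bkerP erefl erefl) xk; apply/(bkerP erefl erefl).
by rewrite -bfun_d xk linear0.
Qed.

Lemma bfun_im x : x \in bker A p n -> x \in bim A p n -> f p n x \in bim B p n.
Proof.
move=> _ /bimP [p' [n' [ep [en [y ->]]]]]; apply/bimP.
by exists p', n', ep, en, (f p' n' y); rewrite bfun_d.
Qed.

Definition homology_map : {linear homology A p n -> homology B p n} :=
  subq_map bfun_ker bfun_im.

Lemma homology_mapE x : x \in bker A p n ->
  homology_map (hclass x) = hclass (f p n x).
Proof. exact: subq_mapE. Qed.

End HomologyMap.

Section BhomCategory.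
Variable r : nat.

Program Definition bid (A : bicx r) : bhom A A :=
  @Bhom r A A (fun p n => idfun) _.

Program Definition bcomp (A B C : bicx r) (g : bhom B C) (f : bhom A B) :
    bhom A C :=
  @Bhom r A C (fun p n => g p n \o f p n) _.
Next Obligation. by move=> *; rewrite /= !bfun_d. Qed.

Lemma homology_map_id (A : bicx r) p n q : homology_map (bid A) p n q = q.
Proof.
by have [x xk ->] := coset_class_surj q; rewrite homology_mapE.
Qed.

Lemma homology_map_comp (A B C : bicx r) (g : bhom B C) (f : bhom A B) p n q :
  homology_map (bcomp g f) p n q = homology_map g p n (homology_map f p n q).
Proof.
have [x xk ->] := coset_class_surj q.
by rewrite (homology_mapE _ xk) (homology_mapE f xk) (homology_mapE g (bfun_ker f xk)).
Qed.

End BhomCategory.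

Section Translation.

(* (T A)^{p,n} = A^{n,2n-p} and (T^{-1} A)^{p,n} = A^{2p-n,p}; the maps on
   indices are inverse to each other. *)
Definition tidx (i : int * int) : int * int := (i.2, 2 * i.2 - i.1).
Definition tidxV (i : int * int) : int * int := (2 * i.1 - i.2, i.1).

Lemma tidxK : cancel tidx tidxV.
Proof. by case=> p n; rewrite /tidx /tidxV /=; congr pair; lia. Qed.
Lemma tidxVK : cancel tidxV tidx.
Proof. by case=> p n; rewrite /tidx /tidxV /=; congr pair; lia. Qed.

Section Steps.
Variables (r : nat) (p n p' n' : int).

Lemma transl_p : n' = n + 1 - r.+1%:Z -> n' = n - r%:Z.
Proof. lia. Qed.
Lemma transl_n : p' = p - r.+1%:Z -> n' = n + 1 - r.+1%:Z ->
  2 * n' - p' = 2 * n - p + 1 - r%:Z.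
Proof. lia. Qed.
Lemma translV_p : p' = p - r%:Z -> n' = n + 1 - r%:Z ->
  2 * p' - n' = 2 * p - n - r.+1%:Z.
Proof. lia. Qed.
Lemma translV_n : p' = p - r%:Z -> p' = p + 1 - r.+1%:Z.
Proof. lia. Qed.
End Steps.

Variable r : nat.

Program Definition transl (A : bicx r) : bicx r.+1 :=
  @Bicx r.+1 (fun p n => A n (2 * n - p))
    (fun p n p' n' ep en => bd A (transl_p en) (transl_n ep en)) _.
Next Obligation. by move=> *; rewrite bdd. Qed.

Program Definition translV (A : bicx r.+1) : bicx r :=
  @Bicx r (fun p n => A (2 * p - n) p)
    (fun p n p' n' ep en => bd A (translV_p ep en) (translV_n ep)) _.
Next Obligation. by move=> *; rewrite bdd. Qed.

Program Definition translV_hom (A B : bicx r.+1) (f : bhom A B) :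
    bhom (translV A) (translV B) :=
  @Bhom r (translV A) (translV B) (fun p n => f (2 * p - n) p) _.
Next Obligation. by move=> *; rewrite /= bfun_d. Qed.

Section HomologyTranslation.
Variables (A : bicx r.+1) (p n : int).

Lemma translV_ker (x : A (2 * p - n) p) :
  (x \in bker (translV A) p n) = (x \in bker A (2 * p - n) p).
Proof.
apply/idP/idP => [/(bkerP erefl erefl) h|h].
  exact/(bkerP (translV_p erefl erefl) (translV_n erefl)).
apply/(bkerP (A := translV A) erefl erefl).
exact: (bkerP (translV_p erefl erefl) (translV_n erefl) x).1 h.
Qed.

Lemma translV_im (x : A (2 * p - n) p) :
  (x \in bim (translV A) p n) = (x \in bim A (2 * p - n) p).
Proof.
apply/idP/idP => /bimP [p' [n' [ep [en [y ->]]]]]; apply/bimP.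
  by exists (2 * p' - n'), p', (translV_p ep en), (translV_n ep), y.
have e : p' = 2 * n' - (2 * n' - p') by lia.
move: ep en y; rewrite e => ep en y.
have ep' : p = n' - r%:Z by lia.
have en' : n = 2 * n' - p' + 1 - r%:Z by lia.
exists n', (2 * n' - p'), ep', en', y => /=.
by congr (bd _ _ _ _); exact: eq_irrelevance.
Qed.

Lemma translV_ker_sub (x : A (2 * p - n) p) :
  x \in bker A (2 * p - n) p -> idfun x \in bker (translV A) p n.
Proof. by rewrite translV_ker. Qed.

Lemma translV_im_sub (x : A (2 * p - n) p) : x \in bker A (2 * p - n) p ->
  x \in bim A (2 * p - n) p -> idfun x \in bim (translV A) p n.
Proof. by rewrite translV_im. Qed.

(* The identification of T^{-1} H(A) with H(T^{-1} A), induced by the identity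
   of A^{2p-n,p}. *)
Definition homology_translV :
    {linear homology A (2 * p - n) p -> homology (translV A) p n} :=
  @subq_map R (A (2 * p - n) p) (translV A p n) _ _ _ _ idfun
    translV_ker_sub translV_im_sub.

Lemma homology_translVE x : x \in bker A (2 * p - n) p ->
  homology_translV (hclass x) = @hclass r (translV A) p n x.
Proof. exact: subq_mapE. Qed.

Lemma homology_translV_bij : bijective homology_translV.
Proof.
apply: subq_map_bij => [x _|x xk]; first by rewrite translV_im.
by exists x; rewrite -?translV_ker // subrr rpred0.
Qed.

End HomologyTranslation.

Lemma homology_translV_nat (A B : bicx r.+1) (f : bhom A B) p n q :
  homology_map (translV_hom f) p n (homology_translV A p n q) =
  homology_translV B p n (homology_map f (2 * p - n) p q).
Proof.
have [x xk ->] := coset_class_surj q.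
rewrite homology_translVE // (homology_mapE f) // homology_translVE ?bfun_ker //.
by apply: (homology_mapE (translV_hom f)); rewrite translV_ker.
Qed.

End Translation.

Section SpectralSequences.

Record spse := SpSe {
  page :> forall r : nat, bicx r;
  phi : forall (r : nat) (p n : int),
    {linear page r.+1 p n -> homology (page r) p n};
  phi_bij : forall r p n, bijective (phi r p n)
}.

Record spse_hom (X Y : spse) := SpSeHom {
  sfun :> forall r, bhom (X r) (Y r);
  sfun_phi : forall r p n (x : X r.+1 p n),
    phi Y r p n (sfun r.+1 p n x) = homology_map (sfun r) p n (phi X r p n x)
}.

Definition spse_hom_eq (X Y : spse) (f g : spse_hom X Y) : Prop :=
  forall r p n, f r p n =1 g r p n.

Definition spse_id (X : spse) : spse_hom X X :=
  @SpSeHom X X (fun r => bid (X r))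
    (fun r p n x => esym (homology_map_id (phi X r p n x))).

Lemma spse_comp_phi (X Y W : spse) (g : spse_hom Y W) (f : spse_hom X Y)
    r p n (x : X r.+1 p n) :
  phi W r p n (bcomp (g r.+1) (f r.+1) p n x) =
  homology_map (bcomp (g r) (f r)) p n (phi X r p n x).
Proof. by rewrite homology_map_comp -!sfun_phi. Qed.

Definition spse_comp (X Y W : spse) (g : spse_hom Y W) (f : spse_hom X Y) :
  spse_hom X W := SpSeHom (spse_comp_phi g f).

Definition spse_iso (X Y : spse) (f : spse_hom X Y) : Prop :=
  exists g : spse_hom Y X,
    spse_hom_eq (spse_comp g f) (spse_id X) /\
    spse_hom_eq (spse_comp f g) (spse_id Y).

End SpectralSequences.

Section Decalage.

Definition bcast (F : int -> int -> lmodType R) (p n p' n' : int)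
    (ep : p = p') (en : n = n') : {linear F p n -> F p' n'} :=
  match ep in _ = p', en in _ = n' return {linear F p n -> F p' n'} with
  | erefl, erefl => idfun
  end.

Lemma bcast_id (F : int -> int -> lmodType R) p n (ep : p = p) (en : n = n) x :
  bcast F ep en x = x.
Proof. by rewrite (eq_axiomK ep) (eq_axiomK en). Qed.

Lemma bcast_eq0 (F : int -> int -> lmodType R) p n p' n' (ep : p = p')
  (en : n = n') x : bcast F ep en x = 0 -> x = 0.
Proof. by case: p' / ep; case: n' / en. Qed.

Lemma bcastK (F : int -> int -> lmodType R) p n p' n' (ep : p = p')
    (en : n = n') (ep' : p' = p) (en' : n' = n) x :
  bcast F ep' en' (bcast F ep en x) = x.
Proof. by case: p' / ep ep'; case: n' / en en' => *; rewrite !bcast_id. Qed.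

Section N.
Variable X : spse.

Section At.
Variables p n : int.

Definition ncarrier : lmodType R :=
  ((X 0 p n * X 1 p n) * (X 0 (p - 1) n * X 1 (p - 1) n))%type.

Lemma d1_n (m : int) : m = m + 1 - 1%:Z.
Proof. lia. Qed.

(* Since hclass is total, phi x1 = [x0] is only meaningful together with
   d_0 x0 = 0, which is part of the condition (likewise for y0, y1). *)
Definition npred : {pred ncarrier} := [pred u : ncarrier |
  let: ((x0, x1), (y0, y1)) := u in
  [&& bd (X 0) erefl erefl x0 == 0, phi X 0 p n x1 == hclass x0,
      bd (X 0) erefl erefl y0 == 0, phi X 0 (p - 1) n y1 == hclass y0 &
      bd (X 1) erefl (d1_n n) x1 == y1]].

Lemma npredP u : u \in npred <->
  [/\ u.1.1 \in bker (X 0) p n, phi X 0 p n u.1.2 = hclass u.1.1,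
      u.2.1 \in bker (X 0) (p - 1) n,
      phi X 0 (p - 1) n u.2.2 = hclass u.2.1 &
      bd (X 1) erefl (d1_n n) u.1.2 = u.2.2].
Proof.
case: u => [[x0 x1] [y0 y1]]; rewrite !inE /=.
split=> [/and5P [? /eqP ? ? /eqP ? /eqP ?]|[? ? ? ? ?]]; first by split.
by apply/and5P; split=> //; apply/eqP.
Qed.

Lemma npred_closed : submod_closed npred.
Proof.
split=> [|a u v /npredP [u1 u2 u3 u4 u5] /npredP [v1 v2 v3 v4 v5]]; apply/npredP.
  by split; rewrite ?rpred0 ?linear0 //= /hclass coset_class0.
have e1 : (a *: u + v).1.1 = a *: u.1.1 + v.1.1 by [].
have e2 : (a *: u + v).1.2 = a *: u.1.2 + v.1.2 by [].
have e3 : (a *: u + v).2.1 = a *: u.2.1 + v.2.1 by [].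
have e4 : (a *: u + v).2.2 = a *: u.2.2 + v.2.2 by [].
rewrite e1 e2 e3 e4; split; try exact: memZD.
- by rewrite linearP u2 v2 /hclass coset_class_linear.
- by rewrite linearP u4 v4 /hclass coset_class_linear.
- by rewrite linearP u5 v5.
Qed.

Definition nsub : submodClosed ncarrier := mk_submod npred_closed.

Lemma nsubP u : u \in nsub <->
  [/\ u.1.1 \in bker (X 0) p n, phi X 0 p n u.1.2 = hclass u.1.1,
      u.2.1 \in bker (X 0) (p - 1) n,
      phi X 0 (p - 1) n u.2.2 = hclass u.2.1 &
      bd (X 1) erefl (d1_n n) u.1.2 = u.2.2].
Proof. exact: npredP. Qed.

Definition nmod : lmodType R := submod_sort nsub.

Definition nelt u (h : u \in nsub) : nmod := exist _ u h.

End At.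

Lemma ncast (n n' : int) : n' = n + 1 - 1%:Z -> n = n'.
Proof. lia. Qed.

Section Differential.
Variables (p n p' n' : int).
Hypotheses (ep : p' = p - 1%:Z) (en : n' = n + 1 - 1%:Z).

Definition nd_fun (u : ncarrier p n) : ncarrier p' n' :=
  ((bcast (X 0) (esym ep) (ncast en) u.2.1, bcast (X 1) (esym ep) (ncast en) u.2.2),
   (0, 0)).

Lemma nd_fun_sub u : u \in nsub p n -> nd_fun u \in nsub p' n'.
Proof.
move=> /nsubP [u1 u2 u3 u4 u5]; apply/nsubP; rewrite /nd_fun.
move: (ncast en) => e; clear en; subst p' n'.
split=> //; [exact: rpred0| |].
  by rewrite linear0 /hclass coset_class0.
by rewrite linear0 -u5 [LHS]/= bdd.
Qed.

Lemma nd_fun_linear : linear nd_fun.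
Proof.
move=> a [[x0 x1] [y0 y1]] [[x0' x1'] [y0' y1']].
have -> : nd_fun (a *: ((x0, x1), (y0, y1)) + ((x0', x1'), (y0', y1'))) =
  ((bcast (X 0) (esym ep) (ncast en) (a *: y0 + y0'),
    bcast (X 1) (esym ep) (ncast en) (a *: y1 + y1')), (0, 0)) by [].
have h (W : lmodType R) : (0 : W) = a *: 0 + 0 by rewrite scaler0 addr0.
by rewrite !linearP [X in (_, (X, _))]h [X in (_, (_, X))]h.
Qed.

Definition nd_sub (u : nmod p n) : nmod p' n' :=
  nelt (nd_fun_sub (valP u)).

Lemma nd_linear : linear nd_sub.
Proof.
move=> a u v; apply: val_inj.
exact: (nd_fun_linear a (val u) (val v)).
Qed.

Definition nd : {linear nmod p n -> nmod p' n'} := mk_lin nd_linear.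

End Differential.

Lemma nd_eq0 (p n p' n' : int) (ep : p' = p - 1%:Z) (en : n' = n + 1 - 1%:Z)
  (u : nmod p n) : (val u).2 = 0 -> nd ep en u = 0.
Proof.
move=> u0; apply: val_inj.
have -> : val (nd ep en u) =
  ((bcast (X 0) (esym ep) (ncast en) (val u).2.1,
    bcast (X 1) (esym ep) (ncast en) (val u).2.2), (0, 0)) by [].
by rewrite u0 !linear0.
Qed.

Lemma nd_dd (p n p' n' p'' n'' : int) (ep : p' = p - 1%:Z) (en : n' = n + 1 - 1%:Z)
  (ep' : p'' = p' - 1%:Z) (en' : n'' = n' + 1 - 1%:Z) u :
  nd ep' en' (nd ep en u) = 0.
Proof. exact: nd_eq0. Qed.

(* The complex N(X)_1; an element (x0,x1;y0,y1) is encoded as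
   ((x0,x1),(y0,y1)). *)
Definition ncx : bicx 1 := Bicx nd_dd.

Section Rho.
Variables p n : int.

Definition rho_fun (u : nmod p n) : X 1 p n := (val u).1.2.

Lemma rho_linear : linear rho_fun.
Proof. by []. Qed.

Definition rho_lin : {linear nmod p n -> X 1 p n} := mk_lin rho_linear.
End Rho.

Lemma rho_d (p n p' n' : int) (ep : p' = p - 1%:Z) (en : n' = n + 1 - 1%:Z) u :
  rho_lin p' n' (nd ep en u) = bd (X 1) ep en (rho_lin p n u).
Proof.
have -> : rho_lin p' n' (nd ep en u) =
  bcast (X 1) (esym ep) (ncast en) (val u).2.2 by [].
have /nsubP [_ _ _ _ <-] := valP u.
rewrite [rho_lin p n u]/=/rho_fun.
subst p'; move: (ncast en) => e; destruct e.
by rewrite (eq_irrelevance en (d1_n n)).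
Qed.

Definition rho : bhom ncx (X 1) := @Bhom 1 ncx (X 1) rho_lin rho_d.

Lemma rho_quasi_iso p n : bijective (homology_map rho p n).
Proof.
apply: subq_map_bij => [u|y].
  move=> /(bkerP (A := ncx) erefl erefl) /(congr1 val) u0.
  move=> /bimP [p' [n' [ep [en [z1 uz1]]]]].
  have /nsubP [x0k x1p _ _ _] := valP u.
  have uE : val u = (((val u).1.1, (val u).1.2), (0, 0)).
    have /(congr1 (fun w => w.1.1)) y0 := u0.
    have /(congr1 (fun w => w.1.2)) y1 := u0.
    have b0 : bcast (X 0) (esym erefl) (ncast erefl) (val u).2.1 = 0 := y0.
    have b1 : bcast (X 1) (esym erefl) (ncast erefl) (val u).2.2 = 0 := y1.
    by case: (val u) (bcast_eq0 b0) (bcast_eq0 b1) => [[? ?] [? ?]] /= -> ->.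
  have [z0 z0k z1z0] := coset_class_surj (phi X 0 p' n' z1).
  have {}uz1 : (val u).1.2 = bd (X 1) ep en z1 by [].
  have e2 : n = n' by lia.
  have h : ((z0, z1), (bcast (X 0) ep e2 (val u).1.1,
                       bcast (X 1) ep e2 (val u).1.2)) \in nsub p' n'.
    move: (val u).1.1 (val u).1.2 x0k x1p uz1 => x0 x1 {u u0 uE}.
    subst p; destruct e2 => x0k x1p uz1.
    apply/nsubP; split=> //.
    by rewrite [RHS]/= uz1 (eq_irrelevance en (d1_n n)).
  apply/(bimP (A := ncx)); exists p', n', ep, en, (nelt h).
  apply: val_inj; rewrite [LHS]uE.
  have -> : val (bd ncx ep en (nelt h)) =
    ((bcast (X 0) (esym ep) (ncast en) (bcast (X 0) ep e2 (val u).1.1),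
      bcast (X 1) (esym ep) (ncast en) (bcast (X 1) ep e2 (val u).1.2)), (0, 0))
    by [].
  by rewrite !bcastK.
move=> yk; have [x0 x0k yx0] := coset_class_surj (phi X 0 p n y).
have h : ((x0, y), (0, 0)) \in nsub p n.
  apply/nsubP; split=> //.
  - exact: rpred0.
  - by rewrite linear0 /hclass coset_class0.
  - exact: (bkerP _ _ y).1 yk.
exists (nelt h); last by rewrite subrr rpred0.
apply/(bkerP (A := ncx) erefl erefl).
by apply: nd_eq0.
Qed.

End N.

Section NMap.
Variables (X Y : spse) (f : spse_hom X Y).

Section At.
Variables p n : int.
Definition nmap_fun (u : ncarrier X p n) : ncarrier Y p n :=
  ((f 0 p n u.1.1, f 1 p n u.1.2), (f 0 (p - 1) n u.2.1, f 1 (p - 1) n u.2.2)).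

Lemma nmap_fun_sub u : u \in nsub X p n -> nmap_fun u \in nsub Y p n.
Proof.
move=> /nsubP [u1 u2 u3 u4 u5]; apply/nsubP; split=> /=.
- exact: bfun_ker.
- by rewrite sfun_phi u2 homology_mapE.
- exact: bfun_ker.
- by rewrite sfun_phi u4 homology_mapE.
- by rewrite -bfun_d u5.
Qed.

Lemma nmap_fun_linear : linear nmap_fun.
Proof.
by move=> a [[x0 x1] [y0 y1]] [[x0' x1'] [y0' y1']]; rewrite /nmap_fun !linearP.
Qed.

Definition nmap_sub (u : nmod X p n) : nmod Y p n :=
  nelt (nmap_fun_sub (valP u)).

Lemma nmap_linear : linear nmap_sub.
Proof.
move=> a u v; apply: val_inj.
exact: (nmap_fun_linear a (val u) (val v)).
Qed.

Definition nmap_lin : {linear nmod X p n -> nmod Y p n} := mk_lin nmap_linear.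
End At.

Lemma bcast_bhom r (A B : bicx r) (g : bhom A B) p n p' n'
    (ep : p = p') (en : n = n') x :
  bcast B ep en (g p n x) = g p' n' (bcast A ep en x).
Proof. by case: p' / ep; case: n' / en. Qed.

Lemma nmap_d (p n p' n' : int) (ep : p' = p - 1%:Z) (en : n' = n + 1 - 1%:Z) u :
  nmap_lin p' n' (nd X ep en u) = nd Y ep en (nmap_lin p n u).
Proof.
apply: val_inj.
have -> : val (nmap_lin p' n' (nd X ep en u)) =
  ((f 0 p' n' (bcast (X 0) (esym ep) (ncast en) (val u).2.1),
    f 1 p' n' (bcast (X 1) (esym ep) (ncast en) (val u).2.2)),
   (f 0 (p' - 1) n' 0, f 1 (p' - 1) n' 0)) by [].
by rewrite !linear0 -!bcast_bhom.
Qed.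

Definition nmap : bhom (ncx X) (ncx Y) := @Bhom 1 (ncx X) (ncx Y) nmap_lin nmap_d.
End NMap.

Section DecObject.
Variable X : spse.

(* Dec(X)_0 = T^{-1} N(X)_1 and Dec(X)_i = T^{-1} X_{i+1} for i >= 1; the
   characteristic maps are phi_1 = T^{-1}(H(rho_1)^{-1} o phi_2) and
   phi_i = T^{-1}(phi_{i+1}) for i >= 2, with H(T^{-1} A) identified with
   T^{-1} H(A). As phi X r is the map X_{r+1} -> H(X_r), dec_phi r is the
   characteristic map usually numbered r + 1. *)
Definition dec_page (r : nat) : bicx r :=
  match r with
  | 0 => translV (ncx X)
  | i.+1 => translV (X i.+2)
  end.

Definition dec_phi (r : nat) (p n : int) :
    {linear dec_page r.+1 p n -> homology (dec_page r) p n} :=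
  match r with
  | 0 => homology_translV (ncx X) p n
           \o (lin_inv (@rho_quasi_iso X (2 * p - n) p) \o phi X 1 (2 * p - n) p)
  | i.+1 => homology_translV (X i.+2) p n \o phi X i.+2 (2 * p - n) p
  end.

Lemma dec_phi_bij r p n : bijective (dec_phi r p n).
Proof.
have bij_inv : bijective (lin_inv (@rho_quasi_iso X (2 * p - n) p)).
  by exists (homology_map (rho X) (2 * p - n) p);
    [exact: lin_invKV|exact: lin_invK].
case: r => [|i]; last first.
  exact: (bij_comp (@homology_translV_bij _ (X i.+2) p n)
                   (@phi_bij X i.+2 (2 * p - n) p)).
exact: (bij_comp (@homology_translV_bij _ (ncx X) p n)
                 (bij_comp bij_inv (@phi_bij X 1 (2 * p - n) p))).
Qed.

Definition dec_spse : spse := SpSe dec_phi_bij.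

End DecObject.

Section DecMap.
Variables (X Y : spse) (f : spse_hom X Y).

Definition dec_fun (r : nat) : bhom (dec_page X r) (dec_page Y r) :=
  match r with
  | 0 => translV_hom (nmap f)
  | i.+1 => translV_hom (f i.+2)
  end.

Lemma dec_fun_phi r p n (x : dec_page X r.+1 p n) :
  dec_phi Y r p n (dec_fun r.+1 p n x) =
  homology_map (dec_fun r) p n (dec_phi X r p n x).
Proof.
case: r p n x => [|i] p n x; last first.
  rewrite [RHS](homology_translV_nat (f i.+2)).
  by congr (homology_translV _ _ _ _); exact: sfun_phi.
rewrite [RHS](homology_translV_nat (nmap f)).
congr (homology_translV _ _ _ _).
set q := phi X 1 (2 * p - n) p x.
apply: (canLR (lin_invK _)).
change (phi Y 1 (2 * p - n) p (dec_fun 1 p n x) =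
  homology_map (rho Y) (2 * p - n) p (homology_map (nmap f) (2 * p - n) p
    (lin_inv (@rho_quasi_iso X (2 * p - n) p) q))).
have -> : phi Y 1 (2 * p - n) p (dec_fun 1 p n x) =
  homology_map (f 1) (2 * p - n) p q by exact: sfun_phi.
have [q' ->] : exists q', q = homology_map (rho X) (2 * p - n) p q'.
  exists (lin_inv (@rho_quasi_iso X (2 * p - n) p) q).
  by rewrite lin_invKV.
rewrite lin_invK -!homology_map_comp.
have [u uk ->] := coset_class_surj q'.
by rewrite !homology_mapE.
Qed.

Definition dec_spse_hom : spse_hom (dec_spse X) (dec_spse Y) :=
  @SpSeHom (dec_spse X) (dec_spse Y) dec_fun dec_fun_phi.
End DecMap.


End Decalage.

Section Filtered.

Record filcx := FilCx {
  fmod :> int -> lmodType R;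
  fd : forall n n' : int, n' = n + 1 -> {linear fmod n -> fmod n'};
  fdd : forall (n n' n'' : int) (e : n' = n + 1) (e' : n'' = n' + 1) x,
    fd e' (fd e x) = 0;
  fil : int -> forall n, submodClosed (fmod n);
  fil_mono : forall p n x, x \in fil p n -> x \in fil (p + 1) n;
  fil_d : forall (p n n' : int) (e : n' = n + 1) x,
    x \in fil p n -> fd e x \in fil p n'
}.

Record filhom (C D : filcx) := FilHom {
  ffun_of :> forall n, {linear C n -> D n};
  ffun_d : forall (n n' : int) (e : n' = n + 1) x,
    ffun_of n' (fd C e x) = fd D e (ffun_of n x);
  ffun_fil : forall p n x, x \in fil C p n -> ffun_of n x \in fil D p n
}.

Lemma fil_le (C : filcx) (p p' n : int) x :
  (p <= p')%R -> x \in fil C p n -> x \in fil C p' n.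
Proof.
move=> le_pp' xp; have [k ->] : exists k : nat, p' = p + k%:Z.
  by exists `|p' - p|%N; lia.
elim: k => [|k IHk]; first by rewrite addr0.
have -> : p + k.+1%:Z = p + k%:Z + 1 by lia.
exact: fil_mono.
Qed.

Section Preimage.
Variables (C : filcx) (p p' n : int).

(* F_p C^n ∩ d^{-1}(F_{p'} C^{n+1}) *)
Definition fil_pre_pred : {pred C n} :=
  [pred x | (x \in fil C p n) && (fd C (erefl (n + 1)) x \in fil C p' (n + 1))].

Lemma fil_pre_closed : submod_closed fil_pre_pred.
Proof.
split=> [|a x y]; rewrite !inE; first by rewrite linear0 !rpred0.
by move=> /andP [x1 x2] /andP [y1 y2]; rewrite linearP !memZD.
Qed.

Definition fil_pre : submodClosed (C n) := mk_submod fil_pre_closed.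

Lemma fil_preP (n' : int) (e : n' = n + 1) x :
  x \in fil_pre <-> x \in fil C p n /\ fd C e x \in fil C p' n'.
Proof.
subst n'; split=> [/andP|] //.
by move=> h; apply/andP.
Qed.

End Preimage.

Section Cycles.
Variable C : filcx.

(* Zc r p n is Z_r^{p,p+n} and Bc r p n is B_r^{p,p+n}, both in C^n. The
   filtration is increasing, and the second superscript p+n is determined by
   p and the degree n, so only (p,n) is recorded. *)
Definition Zc (r : nat) (p n : int) : submodClosed (C n) :=
  fil_pre C p (p - r%:Z) n.

Lemma prev_n (n : int) : n = n - 1 + 1.
Proof. lia. Qed.

Definition Bc_pred (r : nat) (p n : int) : {pred C n} :=
  [pred x | `[< exists u v, [/\ u \in Zc r (p - 1) n,
     v \in Zc r (p + r.+1%:Z - 1) (n - 1) & x = u + fd C (prev_n n) v] >]].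

Lemma Bc_closed r p n : submod_closed (@Bc_pred r p n).
Proof.
split=> [|a x y]; rewrite !inE.
  by apply/asboolP; exists 0, 0; rewrite !rpred0 linear0 addr0.
move=> /asboolP [u [v [uZ vZ ->]]] /asboolP [u' [v' [uZ' vZ' ->]]].
apply/asboolP; exists (a *: u + u'), (a *: v + v'); rewrite !memZD //.
by split=> //; rewrite linearP scalerDr addrACA.
Qed.

Definition Bc (r : nat) (p n : int) : submodClosed (C n) :=
  match r with
  | 0 => fil C (p - 1) n
  | r'.+1 => mk_submod (Bc_closed r' p n)
  end.

Lemma BcP r p n x : x \in Bc r.+1 p n <->
  exists (u : C n) m (e : n = m + 1) (v : C m), [/\ u \in Zc r (p - 1) n,
     v \in Zc r (p + r%:Z) m & x = u + fd C e v].
Proof.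
have ep : p + r.+1%:Z - 1 = p + r%:Z by lia.
rewrite unfold_in /= /Bc_pred ep; split=> [/asboolP [u [v [uZ vZ ->]]]|].
  by exists u, (n - 1), (prev_n n), v.
case=> u [m [e [v [uZ vZ ->]]]]; apply/asboolP.
have em : m = n - 1 by lia.
subst m; exists u, v; split=> //.
by rewrite (eq_irrelevance e (prev_n n)).
Qed.

Lemma ZcP {r : nat} {p n n' : int} (e : n' = n + 1) x :
  x \in Zc r p n <-> x \in fil C p n /\ fd C e x \in fil C (p - r%:Z) n'.
Proof. exact: fil_preP. Qed.

Lemma Bc_sub_Zc r p n x : x \in Bc r p n -> x \in Zc r p n.
Proof.
case: r => [|r] => [xB|/BcP [u [m [e [v [uZ vZ ->]]]]]].
  apply/(ZcP erefl); have xp : x \in fil C p n by apply: fil_le xB; lia.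
  by split=> //; rewrite subr0; exact: fil_d.
have /(ZcP erefl) [u1 u2] := uZ; have /(ZcP e) [v1 v2] := vZ.
apply/(ZcP erefl); rewrite linearD fdd addr0; split.
  apply: rpredD; first by apply: fil_le u1; lia.
  by apply: fil_le v2; lia.
by apply: fil_le u2; lia.
Qed.

(* d maps Z_r^{p,p+n} to Z_r^{p-r,p-r+n+1} and likewise for B_r. *)
Lemma Zc_d (r : nat) (p p' n n' : int) (ep : p' = p - r%:Z) (e : n' = n + 1) x :
  x \in Zc r p n -> fd C e x \in Zc r p' n'.
Proof.
move=> /(ZcP e) [x1 x2]; apply/(ZcP erefl).
by rewrite ep fdd rpred0.
Qed.

Lemma Bc_d (r : nat) (p p' n n' : int) (ep : p' = p - r%:Z) (e : n' = n + 1) x :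
  x \in Zc r p n -> x \in Bc r p n -> fd C e x \in Bc r p' n'.
Proof.
move=> _; case: r ep => [|r] ep.
  by rewrite ep subr0; exact: fil_d.
case/BcP=> u [m [em [v [uZ vZ ->]]]]; apply/BcP.
exists 0, n, e, u; rewrite rpred0 linearD fdd addr0 add0r; split=> //.
by have -> : p' + r%:Z = p - 1 by lia.
Qed.

End Cycles.

Section SpectralSequence.
Variable C : filcx.

(* E_r^{p,q}, a subquotient of C^{q-p}. *)
Definition Emod (r : nat) (p q : int) : lmodType R :=
  subq (Zc C r p (q - p)) (Bc C r p (q - p)).

Lemma E_n (r p q p' q' : int) :
  p' = p - r -> q' = q + 1 - r -> q' - p' = q - p + 1.
Proof. lia. Qed.

Definition Ed (r : nat) (p q p' q' : int) (ep : p' = p - r%:Z) (eq : q' = q + 1 - r%:Z) :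
    {linear Emod r p q -> Emod r p' q'} :=
  subq_map (@Zc_d C r p p' _ _ ep (E_n ep eq))
           (@Bc_d C r p p' _ _ ep (E_n ep eq)).

Lemma EdE (r : nat) (p q p' q' : int) (ep : p' = p - r%:Z) (eq : q' = q + 1 - r%:Z) x :
  x \in Zc C r p (q - p) ->
  Ed ep eq (coset_class _ _ x) = coset_class _ _ (fd C (E_n ep eq) x).
Proof. exact: subq_mapE. Qed.

Lemma Edd (r : nat) (p q p' q' p'' q'' : int) (ep : p' = p - r%:Z) (eq : q' = q + 1 - r%:Z)
    (ep' : p'' = p' - r%:Z) (eq' : q'' = q' + 1 - r%:Z) (x : Emod r p q) :
  Ed ep' eq' (Ed ep eq x) = 0.
Proof.
have [z zZ ->] := coset_class_surj x.
by rewrite (EdE ep eq zZ) (EdE ep' eq' (Zc_d ep _ zZ)) fdd coset_class0.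
Qed.

Definition Epage (r : nat) : bicx r := Bicx (@Edd r).

Lemma Zc_succ r p n (z : C n) : z \in Zc C r.+1 p n -> z \in Zc C r p n.
Proof.
move=> /(ZcP erefl) [z1 z2]; apply/(ZcP erefl); split=> //.
by apply: fil_le z2; lia.
Qed.

Lemma Zc_pred_Bc r p n (z : C n) : z \in Zc C r (p - 1) n -> z \in Bc C r p n.
Proof.
case: r => [|r] zZ; first by have /(ZcP erefl) [] := zZ.
apply/BcP; exists z, (n - 1), (prev_n n), 0.
by rewrite Zc_succ // rpred0 linear0 addr0.
Qed.

Lemma Bc_weak r p n (x : C n) : x \in Bc C r p n ->
  exists (u : C n) m (e : n = m + 1) (v : C m), [/\ u \in fil C (p - 1) n,
     v \in Zc C r (p + r%:Z) m & x = u + fd C e v].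
Proof.
case: r => [xB|r /BcP [u [m [e [v [uZ vZ ->]]]]]].
  by exists x, (n - 1), (prev_n n), 0; rewrite rpred0 linear0 addr0.
exists u, m, e, v; split=> //; first by have /(ZcP erefl) [] := uZ.
have /(ZcP e) [v1 v2] := vZ; apply/(ZcP e); split.
  by apply: fil_le v1; lia.
by apply: fil_le v2; lia.
Qed.

Section Phi.
Variables (r : nat) (p q : int).

Let cl (z : C (q - p)) : Epage r p q :=
  coset_class (Zc C r p (q - p)) (Bc C r p (q - p)) z.

(* The canonical map sends the class of z in E_{r+1} to the class in H(E_r) of
   the class of z in E_r. *)
Definition Ephi_fun (z : C (q - p)) : homology (Epage r) p q :=
  @hclass r (Epage r) p q (coset_class (Zc C r p (q - p)) (Bc C r p (q - p)) z).

Lemma cl_ker z : z \in Zc C r p (q - p) ->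
  cl z \in bker (Epage r) p q <->
  fd C (E_n erefl erefl) z \in Bc C r (p - r%:Z) (q + 1 - r%:Z - (p - r%:Z)).
Proof.
move=> zZ; split=> [/(bkerP (A := Epage r) erefl erefl)|h].
  by rewrite [LHS]EdE // => /(coset_class_eq0 _ (Zc_d erefl _ zZ)).
apply/(bkerP (A := Epage r) erefl erefl); rewrite [LHS]EdE //.
by apply/coset_class_eq0; first exact: Zc_d.
Qed.

Lemma cl_im m (e : q - p = m + 1) w : w \in Zc C r (p + r%:Z) m ->
  cl (fd C e w) \in bim (Epage r) p q.
Proof.
have [q' em] : exists q', m = q' - (p + r%:Z) by exists (m + (p + r%:Z)); lia.
subst m => wZ.
have ep : p = p + r%:Z - r%:Z by lia.
have eq : q = q' + 1 - r%:Z by lia.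
apply/bimP; exists (p + r%:Z), q', ep, eq, (coset_class _ _ w).
by rewrite [RHS]EdE // (eq_irrelevance e (E_n ep eq)).
Qed.

Lemma Ephi_ker z : z \in Zc C r.+1 p (q - p) -> cl z \in bker (Epage r) p q.
Proof.
move=> zZ; apply/cl_ker; first exact: Zc_succ.
have /(ZcP (E_n (erefl (p - r%:Z)) (erefl (q + 1 - r%:Z)))) [z1 z2] := zZ.
apply: Zc_pred_Bc; apply/(ZcP erefl); rewrite fdd rpred0; split=> //.
by apply: fil_le z2; lia.
Qed.

Lemma Ephi_lin a x y :
    x \in Zc C r.+1 p (q - p) -> y \in Zc C r.+1 p (q - p) ->
  Ephi_fun (a *: x + y) = a *: Ephi_fun x + Ephi_fun y.
Proof.
move=> xZ yZ.
rewrite /Ephi_fun (coset_class_linear _ a (Zc_succ xZ) (Zc_succ yZ)).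
exact: (coset_class_linear (bim (Epage r) p q) a (Ephi_ker xZ) (Ephi_ker yZ)).
Qed.

Lemma Ephi_B x : x \in Zc C r.+1 p (q - p) -> x \in Bc C r.+1 p (q - p) ->
  Ephi_fun x = 0.
Proof.
move=> xZ xB; apply/coset_class_eq0; first exact: Ephi_ker.
move: xB => /BcP [u [m [e [v [uZ vZ xE]]]]].
have uB := Zc_pred_Bc uZ; have dvZ : fd C e v \in Zc C r p (q - p).
  by apply: Zc_d vZ; lia.
have -> : coset_class (Zc C r p (q - p)) (Bc C r p (q - p)) x = cl (fd C e v).
  apply/coset_class_eq => //; first exact: Zc_succ.
  by rewrite xE addrK.
exact: cl_im.
Qed.

Definition Ephi : {linear Epage r.+1 p q -> homology (Epage r) p q} :=
  subq_lift Ephi_lin Ephi_B.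

Lemma EphiE z : z \in Zc C r.+1 p (q - p) ->
  Ephi (coset_class _ _ z) = Ephi_fun z.
Proof. exact: subq_liftE. Qed.

Lemma Ephi_bij : bijective Ephi.
Proof.
apply: subq_lift_bij => [z zZ|h].
  move/coset_class_eq0 => /(_ (Ephi_ker zZ)) /bimP [p' [q' [ep [eq [y zy]]]]].
  have [w wZ yw] := coset_class_surj y.
  move: zy; rewrite {}yw [bd _ _ _ _]EdE //.
  have eE := E_n ep eq; rewrite (eq_irrelevance (E_n ep eq) eE).
  move/(coset_class_eq _ (Zc_succ zZ) (Zc_d ep eE wZ)).
  move=> /Bc_weak [u [m [e [v [uF vZ zE]]]]].
  have em : m = q' - p' by lia.
  subst m; rewrite (eq_irrelevance e eE) {e} in zE.
  have epr : p' = p + r%:Z by lia.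
  subst p'; apply/BcP; exists u, _, eE, (v + w).
  have {}zE : z = u + fd C eE (v + w).
    by rewrite linearD addrA -zE subrK.
  split=> //; last exact: rpredD.
  apply/(ZcP erefl); split=> //.
  have /(ZcP erefl) [_] := zZ; rewrite zE linearD fdd addr0.
  by apply: fil_le; lia.
have [y yk ->] := coset_class_surj h.
move: yk; have [z zZ ->] := coset_class_surj y => yk.
have := (cl_ker zZ).1 yk.
move: (E_n _ _); move: (q + 1 - r%:Z - (p - r%:Z)) => n' e dzB.
suff [v [vZ vB zvZ]] : exists v, [/\ v \in Zc C r p (q - p),
    v \in Bc C r p (q - p) & z - v \in Zc C r.+1 p (q - p)].
  exists (z - v); first exact: zvZ.
  apply: (congr1 (@hclass r (Epage r) p q)).
  apply/(coset_class_eq _ zZ (Zc_succ zvZ)).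
  by rewrite opprB [z + _]addrC subrK.
have /(ZcP e) [z1 z2] := zZ.
move: dzB; case: (r) zZ => [|r'] zZ.
  rewrite [_ \in Bc _ _ _ _]/= => dzF; exists 0; rewrite !rpred0 subr0; split=> //.
  by apply/(ZcP e); split=> //; apply: fil_le dzF; lia.
case/BcP=> u [m [em [v [uZ vZ dz]]]].
have mE : m = q - p by lia.
subst m; rewrite (eq_irrelevance em e) {em} in dz.
have vB : v \in Bc C r'.+1 p (q - p).
  apply/BcP; exists v, (q - p - 1), (prev_n _), 0.
  rewrite rpred0 linear0 addr0; split=> //.
  by have <- : p - r'.+1%:Z + r'%:Z = p - 1 by lia.
exists v; split=> //; first exact: Bc_sub_Zc.
apply/(ZcP e); split.
  apply: memB; first by have /(ZcP e) [] := zZ.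
  by have /(ZcP e) [] := Bc_sub_Zc vB.
rewrite linearB dz addrK; have /(ZcP erefl) [u1 _] := uZ.
by apply: fil_le u1; lia.
Qed.

End Phi.

Definition spseE : spse := SpSe Ephi_bij.

End SpectralSequence.

Section EMap.
Variables (C D : filcx) (f : filhom C D).

Lemma ffun_Z r p n x : x \in Zc C r p n -> f n x \in Zc D r p n.
Proof.
move=> /(ZcP erefl) [x1 x2]; apply/(ZcP erefl).
by rewrite -ffun_d; split; exact: ffun_fil.
Qed.

Lemma ffun_B r p n x :
  x \in Zc C r p n -> x \in Bc C r p n -> f n x \in Bc D r p n.
Proof.
move=> _; case: r => [|r]; first exact: ffun_fil.
move=> /BcP [u [m [e [v [uZ vZ ->]]]]]; apply/BcP.
by exists (f n u), m, e, (f m v); rewrite linearD ffun_d !ffun_Z.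
Qed.

Definition Emap_lin r p q : {linear Epage C r p q -> Epage D r p q} :=
  subq_map (@ffun_Z r p (q - p)) (@ffun_B r p (q - p)).

Lemma Emap_linE r p q x : x \in Zc C r p (q - p) ->
  Emap_lin r p q (coset_class _ _ x) = coset_class _ _ (f (q - p) x).
Proof. exact: subq_mapE. Qed.

Lemma Emap_d (r : nat) (p q p' q' : int) (ep : p' = p - r%:Z) (eq : q' = q + 1 - r%:Z) x :
  Emap_lin r p' q' (bd (Epage C r) ep eq x) =
  bd (Epage D r) ep eq (Emap_lin r p q x).
Proof.
have [z zZ ->] := coset_class_surj x.
rewrite (Emap_linE zZ) [bd (Epage C r) ep eq _](EdE ep eq zZ).
rewrite (Emap_linE (Zc_d ep _ zZ)) [RHS](EdE ep eq (ffun_Z zZ)).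
by rewrite ffun_d.
Qed.

Definition Emap r : bhom (Epage C r) (Epage D r) := Bhom (@Emap_d r).

Lemma Emap_phi r p q (x : Epage C r.+1 p q) :
  Ephi D r p q (Emap r.+1 p q x) =
  homology_map (Emap r) p q (Ephi C r p q x).
Proof.
have [z zZ ->] := coset_class_surj x.
have -> : Emap r.+1 p q (coset_class _ _ z) = coset_class _ _ (f (q - p) z).
  exact: Emap_linE.
rewrite [LHS](EphiE (ffun_Z zZ)) [Ephi _ _ _ _ _](EphiE zZ).
rewrite [RHS](homology_mapE (Emap r) (Ephi_ker zZ)).
apply: (congr1 (@hclass r (Epage D r) p q)).
exact/esym/(Emap_linE (Zc_succ zZ)).
Qed.

Definition spseE_hom : spse_hom (spseE C) (spseE D) :=
  @SpSeHom (spseE C) (spseE D) Emap Emap_phi.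

End EMap.

Section DecFiltered.

(* F_p(Dec C)^n = F_{p-n} C^n ∩ d^{-1}(F_{p-n-1} C^{n+1}) *)
Definition dec_fil (C : filcx) (p n : int) : submodClosed (C n) :=
  fil_pre C (p - n) (p - n - 1) n.

Lemma dec_fil_mono (C : filcx) p n x :
  x \in dec_fil C p n -> x \in dec_fil C (p + 1) n.
Proof.
move=> /(fil_preP _ _ erefl) [x1 x2]; apply/(fil_preP _ _ erefl).
by split; [apply: fil_le x1|apply: fil_le x2]; lia.
Qed.

Lemma dec_fil_d (C : filcx) (p n n' : int) (e : n' = n + 1) x :
  x \in dec_fil C p n -> fd C e x \in dec_fil C p n'.
Proof.
move=> /(fil_preP _ _ e) [x1 x2]; apply/(fil_preP _ _ erefl).
by rewrite fdd rpred0; split=> //; apply: fil_le x2; lia.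
Qed.

Definition dec_filcx (C : filcx) : filcx :=
  FilCx (@fdd C) (@dec_fil_mono C) (@dec_fil_d C).

Lemma dec_ffun_fil (C D : filcx) (f : filhom C D) p n x :
  x \in fil (dec_filcx C) p n -> f n x \in fil (dec_filcx D) p n.
Proof.
move=> /(fil_preP _ _ erefl) [x1 x2]; apply/(fil_preP _ _ erefl).
by rewrite -ffun_d; split; exact: ffun_fil.
Qed.

Definition dec_filhom (C D : filcx) (f : filhom C D) :
    filhom (dec_filcx C) (dec_filcx D) :=
  @FilHom (dec_filcx C) (dec_filcx D) f (@ffun_d C D f) (@dec_ffun_fil C D f).

End DecFiltered.

End Filtered.

End Bigraded.

(* Main.v *)
Require Import Defs.
From mathcomp Require Import all_boot all_order all_algebra.
From mathcomp Require Import zify.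

(** Write s = p - n for a degree n, so that T^{-1} puts in bidegree (p, p + n)
    the entry of filtration s and of the same cochain degree n.  Both spectral
    sequences are then made of subquotients of the same module C^n, and the
    isomorphism sends the class of a representative z to a class of the same z.

    From page 1 on there is nothing but bookkeeping: unfolding the filtration
    of Dec(C) gives Z_r^p(Dec C) = Z_{r+1}^s(C) for r >= 0 ([dec_Zc]) and
    B_r^p(Dec C) = B_{r+1}^s(C) for r >= 1 ([dec_Bc]), so
    E_r(Dec C) = E_{r+1}(C) up to reindexing.

    On page 0 the cycles still agree, E_0(Dec C) = Z_1^s / Z_1^{s-1}, but the
    denominator is smaller than B_1^s.  The map is
    z |-> ([z]_0, [z]_1; [dz]_0, [dz]_1) with values in N(E(C))_1.  An element z
    of the kernel has [z]_0 = 0 and [dz]_0 = 0, that is z in F_{s-1} and dz in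
    F_{s-2}, which says that z is in Z_1^{s-1} ([nclass_eq0]).  For surjectivity
    ([nclass_surj]), a representative of x_1 has the right x_0 and y_0 only up
    to boundaries [dw]_0 and [dv]_0, because phi_1 sees classes in H(E_0);
    adding dw and v to it corrects x_0 and y_0 and changes neither [z]_1 nor
    [dz]_1.

    Composing the page-0 map with rho_1 gives z |-> [z]_1, which is why the
    maps commute with the first characteristic map ([dclass_phi]).  A morphism
    of spectral sequences that is bijective on all pages is an isomorphism
    ([pagewise_iso]), and naturality holds because every map is given by z
    itself. *)

Set Implicit Arguments.
Unset Strict Implicit.
Unset Printing Implicit Defensive.

Import GRing.Theory.
Local Open Scope ring_scope.

(** * Classes of cochains in the pages *)

Section Degrees.
Variables (R : comPzRingType) (C : filcx R).

Definition ccast (m m' : int) (e : m = m') : {linear C m -> C m'} :=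
  match e in _ = m' return {linear C m -> C m'} with erefl => idfun end.

Lemma ccast_id m (e : m = m) x : ccast e x = x.
Proof. by rewrite (eq_axiomK e). Qed.

(** The degree m is independent of q - p because the two sides of the comparison
    write the same degree in two ways, as q - p and as p - (2p - q). *)
Definition eclass (r : nat) (p q m : int) (e : m = q - p) (z : C m) :
    Epage C r p q :=
  coset_class (Zc C r p (q - p)) (Bc C r p (q - p)) (ccast e z).

Section Class.
Variables (r : nat) (p q m : int) (e : m = q - p).

Lemma eclass_linear a : {in Zc C r p m &, forall x y,
  eclass r e (a *: x + y) = a *: eclass r e x + eclass r e y}.
Proof.
subst m => x y xZ yZ.
by rewrite /eclass linearP coset_class_linear // ccast_id.
Qed.

Lemma eclass_eq0 z : z \in Zc C r p m -> eclass r e z = 0 <-> z \in Bc C r p m.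
Proof. by subst m => zZ; rewrite /eclass ccast_id coset_class_eq0. Qed.

Lemma eclassD : {in Zc C r p m &, forall x y,
  eclass r e (x + y) = eclass r e x + eclass r e y}.
Proof.
by move=> x y xZ yZ; rewrite -{1}[x]scale1r eclass_linear // scale1r.
Qed.

Lemma eclass0 : eclass r e 0 = 0.
Proof. by rewrite /eclass linear0 coset_class0. Qed.

Lemma eclass_surj (x : Epage C r p q) :
  exists2 z, z \in Zc C r p m & x = eclass r e z.
Proof.
subst m; have [z zZ ->] := coset_class_surj x.
by exists z => //; rewrite /eclass ccast_id.
Qed.

Lemma bcast_eclass p' q' (ep : p = p') (eq : q = q') (e' : m = q' - p') z :
  bcast (Epage C r) ep eq (eclass r e z) = eclass r e' z.
Proof. by subst p' q'; rewrite (eq_irrelevance e' e). Qed.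

Lemma eclass_d (p' q' m' : int) (ep : p' = p - r%:Z) (eq : q' = q + 1 - r%:Z)
    (em : m' = m + 1) (e' : m' = q' - p') z : z \in Zc C r p m ->
  bd (Epage C r) ep eq (eclass r e z) = eclass r e' (fd C em z).
Proof.
move: em; subst m m' => em zZ.
by rewrite [LHS](EdE ep eq zZ) (eq_irrelevance em (E_n ep eq)).
Qed.

Lemma eclass_phi z : z \in Zc C r.+1 p m ->
  phi (spseE C) r p q (eclass r.+1 e z) = hclass (eclass r e z).
Proof.
by subst m => zZ; rewrite [LHS]EphiE ccast_id // /Ephi_fun /eclass ccast_id.
Qed.

Lemma eclass_ker z : z \in Zc C r.+1 p m ->
  eclass r e z \in bker (Epage C r) p q.
Proof. by subst m => zZ; rewrite /eclass ccast_id; exact: Ephi_ker. Qed.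

End Class.

(** The preimage under d_r can be lifted to a cochain, so boundaries of E_r are
    classes of honest coboundaries d w. *)
Lemma bim_eclass r p q m (e : m = q - p) (x : Epage C r p q) :
    x \in bim (Epage C r) p q ->
  exists n (en : m = n + 1), exists2 w, w \in Zc C r (p + r%:Z) n &
    x = eclass r e (fd C en w).
Proof.
move=> /bimP [p' [q' [ep [eq [y ->]]]]].
have e' : m - 1 = q' - p' by lia.
have [w wZ ->] := eclass_surj e' y.
exists (m - 1), (prev_n m), w; first by have -> : p + r%:Z = p' by lia.
exact: eclass_d.
Qed.

End Degrees.

(** * Cycles and boundaries of the shifted filtration *)

Section Cycles.
Variables (R : comPzRingType) (C : filcx R).

Lemma Zc0 p n (x : C n) : (x \in Zc C 0 p n) = (x \in fil C p n).
Proof.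
apply/idP/idP=> [/(ZcP erefl) []|xF] //; apply/(ZcP erefl).
by rewrite subr0; split=> //; exact: fil_d.
Qed.

Lemma Zc_Bc r p n (x : C n) : x \in Zc C r (p - 1) n -> x \in Bc C r.+1 p n.
Proof.
move=> xZ; apply/BcP; exists x, (n - 1), (prev_n n), 0.
by rewrite rpred0 linear0 addr0.
Qed.

Lemma Zc_d_Bc r p n m (e : m = n + 1) (x : C n) :
  x \in Zc C r (p + r%:Z) n -> fd C e x \in Bc C r.+1 p m.
Proof. by move=> xZ; apply/BcP; exists 0, n, e, x; rewrite rpred0 add0r. Qed.

End Cycles.

Section DecCycles.
Variables (R : comPzRingType) (C : filcx R).

(** Of the four conditions that define the left side, z in F_{p-n} and
    dz in F_{p-r-n-1} imply the two others: dz in F_{p-n-1} is weaker, and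
    ddz = 0. *)
Lemma dec_Zc r p s n (x : C n) : s = p - n ->
  (x \in Zc (dec_filcx C) r p n) = (x \in Zc C r.+1 s n).
Proof.
move=> ->; apply/idP/idP=> [/(ZcP erefl)|/(ZcP erefl) [x1 x2]].
  case=> /(fil_preP _ _ erefl) [x1 _] /(fil_preP _ _ erefl) [x2 _].
  apply/(ZcP erefl); split=> //.
  by have -> : p - n - r.+1%:Z = p - r%:Z - (n + 1) by lia.
apply/(ZcP (C := dec_filcx C) erefl); split; apply/(fil_preP _ _ erefl).
  by split=> //; apply: fil_le x2; lia.
rewrite [fd (dec_filcx C) _ _]/= fdd rpred0; split=> //.
by have -> : p - r%:Z - (n + 1) = p - n - r.+1%:Z by lia.
Qed.

(** The analogue for B_0(Dec C) = F_{p-1}(Dec C) fails: it is Z_1^{s-1} and not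
    B_1^s, and so page 0 needs the complex N. *)
Lemma dec_Bc r p s n (x : C n) : s = p - n ->
  (x \in Bc (dec_filcx C) r.+1 p n) = (x \in Bc C r.+2 s n).
Proof.
move=> sE; apply/idP/idP=> /BcP [u [m [e [v [uZ vZ xE]]]]]; apply/BcP;
  exists u, m, e, v; split=> //.
- by move: uZ; rewrite (@dec_Zc _ _ (s - 1)) //; lia.
- by move: vZ; rewrite (@dec_Zc _ _ (s + r.+1%:Z)) //; lia.
- by rewrite (@dec_Zc _ _ (s - 1)) //; lia.
- by rewrite (@dec_Zc _ _ (s + r.+1%:Z)) //; lia.
Qed.

End DecCycles.

(** * Page 0: the complex N(E(C)) *)

Section Comparison.
Variables (R : comPzRingType) (C : filcx R).

Section NClass.
Variables (s t m : int) (e : m = t - s).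

Lemma nclass_deg : m + 1 = t - (s - 1).
Proof. by rewrite e; lia. Qed.

(** Here [z]_1 and [dz]_1 make sense only when z is in Z_1^s. *)
Definition nclass_raw (z : C m) : ncarrier (spseE C) s t :=
  ((eclass 0 e z, eclass 1 e z),
   (eclass 0 nclass_deg (fd C erefl z), eclass 1 nclass_deg (fd C erefl z))).

Lemma nclass_dZ r z : z \in Zc C 1 s m ->
  fd C (erefl (m + 1)) z \in Zc C r (s - 1) (m + 1).
Proof.
by move=> /(ZcP erefl) [_ dz]; apply/(ZcP erefl); rewrite fdd rpred0.
Qed.

Lemma nclass_raw_sub z : z \in Zc C 1 s m ->
  nclass_raw z \in nsub (spseE C) s t.
Proof.
move=> zZ; have dzZ := nclass_dZ 1 zZ.
apply/nsubP; split; rewrite ?[(nclass_raw z)]/=.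
- exact: eclass_ker.
- exact: eclass_phi.
- exact: eclass_ker.
- exact: eclass_phi.
- exact: eclass_d.
Qed.

(** Extended by 0 outside Z_1^s, to be a function on all of C^m. *)
Definition nclass (z : C m) : ncx (spseE C) s t :=
  insubd (0 : nmod (spseE C) s t) (nclass_raw z).

Lemma val_nclass z : z \in Zc C 1 s m -> val (nclass z) = nclass_raw z.
Proof. by move=> zZ; rewrite insubdK //; exact: nclass_raw_sub. Qed.

Lemma nclass_linear a : {in Zc C 1 s m &, forall x y,
  nclass (a *: x + y) = a *: nclass x + nclass y}.
Proof.
move=> x y xZ yZ; apply: val_inj; apply: (etrans (val_nclass (memZD a xZ yZ))).
apply: (etrans _ (congr2 (fun u v : ncarrier (spseE C) s t => a *: u + v)
  (esym (val_nclass xZ)) (esym (val_nclass yZ)))).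
rewrite /nclass_raw.
have dE : fd C (erefl (m + 1)) (a *: x + y) =
    a *: fd C (erefl (m + 1)) x + fd C (erefl (m + 1)) y by exact: linearP.
rewrite dE (eclass_linear e a xZ yZ).
rewrite (eclass_linear e a (Zc_succ xZ) (Zc_succ yZ)).
rewrite (eclass_linear nclass_deg a (nclass_dZ 0 xZ) (nclass_dZ 0 yZ)).
by rewrite (eclass_linear nclass_deg a (nclass_dZ 1 xZ) (nclass_dZ 1 yZ)).
Qed.

(** The components [z]_0 and [dz]_0 already determine the kernel; conversely
    Z_1^{s-1} lies in B_1^s, and dz lies in Z_r^{s-2} for every r. *)
Lemma nclass_eq0 z : z \in Zc C 1 s m ->
  nclass z = 0 <-> z \in Zc C 1 (s - 1) m.
Proof.
move=> zZ; have val0 : val (0 : nmod (spseE C) s t) = ((0, 0), (0, 0)) by [].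
split=> [/(congr1 val)|zZ'].
  rewrite val_nclass // val0 => -[/(eclass_eq0 _ (Zc_succ zZ)) z0 _ + _].
  move=> /(eclass_eq0 _ (nclass_dZ 0 zZ)) dz0.
  exact/(ZcP erefl).
apply: val_inj; rewrite val_nclass // val0 /nclass_raw.
have /(ZcP erefl) [z1 z2] := zZ'.
have dzZ r : fd C (erefl (m + 1)) z \in Zc C r (s - 1 - 1) (m + 1).
  by apply/(ZcP erefl); rewrite fdd rpred0.
congr ((_, _), (_, _)).
- exact/(eclass_eq0 e (Zc_succ zZ)).
- exact/(eclass_eq0 e zZ)/Zc_pred_Bc.
- exact/(eclass_eq0 _ (nclass_dZ 0 zZ))/Zc_pred_Bc.
- exact/(eclass_eq0 _ (nclass_dZ 1 zZ))/Zc_pred_Bc.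
Qed.

(** The required z is z1 + dw + v, where z1 represents x_1, dw corrects the
    component x_0 and v, of filtration s - 1, corrects y_0 = [dz]_0. *)
Lemma nclass_surj (u : ncx (spseE C) s t) :
  exists2 z, z \in Zc C 1 s m & u = nclass z.
Proof.
have /nsubP [] := valP u.
case uE : (val u) => [[x0 x1] [y0 y1]].
rewrite ![(_, _).1]/= ![(_, _).2]/= => x0k x1x0 y0k y1y0 dx1.
have [z1 z1Z x1E] := eclass_surj e x1.
have y1E : y1 = eclass 1 nclass_deg (fd C (erefl (m + 1)) z1).
  by rewrite -dx1 x1E; exact: eclass_d.
(* Both x_0 and [z1]_0 represent phi_1(x_1) in H(E_0). *)
have : x0 - eclass 0 e z1 \in bim (Epage C 0) s t.
  apply/(coset_class_eq (bim (Epage C 0) s t) x0k (eclass_ker e z1Z)).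
  by rewrite -[LHS]x1x0 x1E; exact: eclass_phi.
move=> /(bim_eclass e) [n [en [w wZ x0E]]].
have : y0 - eclass 0 nclass_deg (fd C (erefl (m + 1)) z1) \in
    bim (Epage C 0) (s - 1) t.
  apply/(coset_class_eq (bim (Epage C 0) (s - 1) t) y0k).
    exact/eclass_ker/nclass_dZ.
  by rewrite -[LHS]y1y0 y1E; apply: eclass_phi; exact: nclass_dZ.
move=> /(bim_eclass nclass_deg) [n' [en' [v vZ y0E]]].
have n'E : n' = m by lia.
subst n'; rewrite (eq_irrelevance en' erefl) {en'} in y0E.
(* The corrections dw, v and dv are boundaries for page 1. *)
have dwB := Zc_d_Bc en wZ; have dvB := Zc_d_Bc erefl vZ.
have dwZ := Bc_sub_Zc dwB; have dvZ := Bc_sub_Zc dvB.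
have vB : v \in Bc C 1 s m by apply: Zc_Bc; rewrite addr0 in vZ.
have vZ1 := Bc_sub_Zc vB.
have zwZ : z1 + fd C en w \in Zc C 1 s m by exact: rpredD.
have zZ : z1 + fd C en w + v \in Zc C 1 s m by exact: rpredD.
have v0 : eclass 0 e v = 0.
  by apply/(eclass_eq0 e (Zc_succ vZ1)); rewrite addr0 Zc0 in vZ.
have e0 : eclass 0 e (z1 + fd C en w + v) = x0.
  rewrite (eclassD e (Zc_succ zwZ) (Zc_succ vZ1)) v0 addr0.
  rewrite (eclassD e (Zc_succ z1Z) (Zc_succ dwZ)).
  move: x0E; set a := eclass 0 e _; set b := eclass 0 e _ => <-.
  by rewrite (addrC a) subrK.
have e1 : eclass 1 e (z1 + fd C en w + v) = x1.
  rewrite (eclassD e zwZ vZ1) (eclassD e z1Z dwZ) -x1E.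
  by rewrite ((eclass_eq0 e dwZ).2 dwB) ((eclass_eq0 e vZ1).2 vB) !addr0.
have f0 : eclass 0 nclass_deg (fd C (erefl (m + 1)) (z1 + fd C en w + v)) = y0.
  rewrite !linearD fdd addr0.
  rewrite (eclassD nclass_deg (nclass_dZ 0 z1Z) (nclass_dZ 0 vZ1)).
  move: y0E; set a := eclass 0 _ _; set b := eclass 0 _ _ => <-.
  by rewrite (addrC a) subrK.
have f1 : eclass 1 nclass_deg (fd C (erefl (m + 1)) (z1 + fd C en w + v)) = y1.
  rewrite !linearD fdd addr0 y1E.
  rewrite (eclassD nclass_deg (nclass_dZ 1 z1Z) (nclass_dZ 1 vZ1)).
  by rewrite ((eclass_eq0 nclass_deg dvZ).2 dvB) addr0.
exists (z1 + fd C en w + v); first exact: zZ.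
by apply: val_inj; rewrite (val_nclass zZ) uE /nclass_raw e0 e1 f0 f1.
Qed.

End NClass.

(** * The comparison map *)

Section DecClass.
Variables (r : nat) (p q m : int) (e : m = q - p).

Lemma dclass_deg : m = p - (2 * p - q).
Proof. by rewrite e; lia. Qed.

Lemma dclass_s : 2 * p - q = p - m.
Proof. by rewrite e; lia. Qed.

Definition dclass : C m -> dec_page (spseE C) r p q :=
  match r with
  | 0 => nclass dclass_deg
  | i.+1 => eclass i.+2 dclass_deg
  end.

Lemma dclass_linear a : {in Zc (dec_filcx C) r p m &, forall x y,
  dclass (a *: x + y) = a *: dclass x + dclass y}.
Proof.
rewrite /dclass => x y; rewrite !(dec_Zc (C := C) _ _ dclass_s).
case: r => [|i] xZ yZ.
  exact: nclass_linear.
exact: eclass_linear.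
Qed.

Lemma dclass_eq0 z : z \in Zc (dec_filcx C) r p m ->
  dclass z = 0 <-> z \in Bc (dec_filcx C) r p m.
Proof.
rewrite /dclass (dec_Zc (C := C) _ _ dclass_s); case: r => [|i] zZ.
  have -> : (z \in Bc (dec_filcx C) 0 p m) = (z \in Zc C 1 (2 * p - q - 1) m).
    have -> : 2 * p - q - 1 = p - 1 - m by have := dclass_s; lia.
    by [].
  exact: nclass_eq0.
by rewrite (dec_Bc (C := C) _ _ dclass_s); exact: eclass_eq0.
Qed.

Lemma dclass_surj (x : dec_page (spseE C) r p q) :
  exists2 z, z \in Zc (dec_filcx C) r p m & x = dclass z.
Proof.
rewrite /dclass; move: x; case: r => [|i] x.
  have [z zZ ->] := nclass_surj dclass_deg x.
  by exists z => //; rewrite (dec_Zc (C := C) _ _ dclass_s).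
have [z zZ ->] := eclass_surj dclass_deg x.
by exists z => //; rewrite (dec_Zc (C := C) _ _ dclass_s).
Qed.

End DecClass.

Lemma nclass_d (s t m s' t' m' : int) (e : m = t - s) (e' : m' = t' - s')
    (es : s' = s - 1%:Z) (et : t' = t + 1 - 1%:Z) (em : m' = m + 1) z :
  z \in Zc C 1 s m ->
  nd (spseE C) es et (nclass e z) = nclass e' (fd C em z).
Proof.
move: e'; subst m' => e' zZ.
have dzZ : fd C (erefl (m + 1)) z \in Zc C 1 s' (m + 1) by exact: Zc_d zZ.
apply: val_inj; rewrite val_nclass // [LHS]/= /nd_fun val_nclass //.
rewrite /nclass_raw [X in ((X, _), _)]/= fdd !eclass0.
congr ((_, _), _).
all: exact: bcast_eclass.
Qed.

Lemma dclass_d r (p q m p' q' m' : int) (e : m = q - p) (e' : m' = q' - p')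
    (ep : p' = p - r%:Z) (eq : q' = q + 1 - r%:Z) (em : m' = m + 1) z :
  z \in Zc (dec_filcx C) r p m ->
  bd (dec_page (spseE C) r) ep eq (dclass r e z) = dclass r e' (fd C em z).
Proof.
rewrite (dec_Zc (C := C) _ _ (dclass_s e)); case: r ep eq => [|i] ep eq zZ.
  exact: nclass_d.
exact: eclass_d.
Qed.

(** For r = 0 the characteristic map of Dec(E(C)) inverts H(rho_1), so the claim
    is checked after applying rho_1, where the tuple of z becomes [z]_1. *)
Lemma dclass_phi r (p q m : int) (e : m = q - p) z :
    z \in Zc (dec_filcx C) r.+1 p m ->
    dclass r e z \in bker (dec_page (spseE C) r) p q ->
  phi (dec_spse (spseE C)) r p q (dclass r.+1 e z) = hclass (dclass r e z).
Proof.
rewrite (dec_Zc (C := C) _ _ (dclass_s e)); case: r => [|i] zZ zk.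
  rewrite translV_ker in zk; rewrite -[RHS](homology_translVE zk).
  congr (homology_translV _ _ _ _); apply: (canLR (lin_invK _)).
  rewrite (homology_mapE (rho _) zk) [LHS](eclass_phi (dclass_deg e) zZ).
  apply: (congr1 (@hclass R 1 (Epage C 1) _ _)).
  by rewrite [RHS]/= /rho_fun val_nclass //; exact: Zc_succ.
rewrite translV_ker in zk; rewrite -[RHS](homology_translVE zk).
apply: (congr1 (homology_translV (Epage C i.+2) p q)).
exact: (eclass_phi (dclass_deg e)).
Qed.

Section Page.
Variables (r : nat) (p q : int).

Let dec_class (z : dec_filcx C (q - p)) : dec_page (spseE C) r p q :=
  dclass r erefl z.

Lemma dec_comparison_lin_linear a x y :
    x \in Zc (dec_filcx C) r p (q - p) -> y \in Zc (dec_filcx C) r p (q - p) ->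
  dec_class (a *: x + y) = a *: dec_class x + dec_class y.
Proof. exact: dclass_linear. Qed.

Lemma dec_comparison_lin_B x : x \in Zc (dec_filcx C) r p (q - p) ->
  x \in Bc (dec_filcx C) r p (q - p) -> dec_class x = 0.
Proof. by move=> xZ /(dclass_eq0 erefl xZ). Qed.

Definition dec_comparison_lin :
    {linear Epage (dec_filcx C) r p q -> dec_page (spseE C) r p q} :=
  subq_lift dec_comparison_lin_linear dec_comparison_lin_B.

Lemma dec_comparison_linE m (e : m = q - p) z : z \in Zc (dec_filcx C) r p m ->
  dec_comparison_lin (eclass (C := dec_filcx C) r e z) = dclass r e z.
Proof. by subst m => zZ; rewrite /eclass ccast_id [LHS]subq_liftE. Qed.

Lemma dec_comparison_lin_bij : bijective dec_comparison_lin.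
Proof.
apply: subq_lift_bij => [x xZ|w]; first by move/dclass_eq0; exact.
exact: dclass_surj.
Qed.

End Page.

Lemma dec_comparison_d r (p q p' q' : int)
    (ep : p' = p - r%:Z) (eq : q' = q + 1 - r%:Z) x :
  dec_comparison_lin r p' q' (bd (Epage (dec_filcx C) r) ep eq x) =
  bd (dec_page (spseE C) r) ep eq (dec_comparison_lin r p q x).
Proof.
have [z zZ ->] := eclass_surj (C := dec_filcx C) erefl x.
have e' : q - p + 1 = q' - p' by lia.
rewrite (eclass_d erefl ep eq erefl e' zZ).
rewrite !dec_comparison_linE //; last exact: Zc_d zZ.
by rewrite [RHS](dclass_d erefl e' ep eq erefl zZ).
Qed.

Definition dec_comparison_page r :
    bhom (Epage (dec_filcx C) r) (dec_page (spseE C) r) :=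
  Bhom (@dec_comparison_d r).

Lemma dec_comparison_phi r p q (x : Epage (dec_filcx C) r.+1 p q) :
  phi (dec_spse (spseE C)) r p q (dec_comparison_page r.+1 p q x) =
  homology_map (dec_comparison_page r) p q (phi (spseE (dec_filcx C)) r p q x).
Proof.
have [z zZ ->] := eclass_surj (C := dec_filcx C) erefl x.
have zk := eclass_ker (erefl (q - p)) zZ.
rewrite (eclass_phi _ zZ) (homology_mapE (dec_comparison_page r) zk).
have pageE :
    dec_comparison_page r p q (eclass (C := dec_filcx C) r erefl z) =
    dclass r erefl z.
  by apply: dec_comparison_linE; exact: Zc_succ.
have := bfun_ker (dec_comparison_page r) zk; rewrite pageE => dzk.
rewrite [dec_comparison_page _ _ _ _](dec_comparison_linE erefl zZ).
exact: dclass_phi.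
Qed.

Definition dec_comparison :
    spse_hom (spseE (dec_filcx C)) (dec_spse (spseE C)) :=
  @SpSeHom R (spseE (dec_filcx C)) (dec_spse (spseE C))
    dec_comparison_page dec_comparison_phi.

End Comparison.

(** * Pagewise bijective morphisms *)

Section PagewiseIso.
Variables (R : comPzRingType) (X Y : spse R) (f : spse_hom X Y).
Hypothesis f_bij : forall r p n, bijective (f r p n).

Let g r p n : {linear Y r p n -> X r p n} := lin_inv (f_bij r p n).

Lemma page_inv_d r (p n p' n' : int) (ep : p' = p - r%:Z)
    (en : n' = n + 1 - r%:Z) y :
  g r p' n' (bd (Y r) ep en y) = bd (X r) ep en (g r p n y).
Proof. by apply: (canLR (lin_invK _)); rewrite bfun_d lin_invKV. Qed.

Definition page_inv r : bhom (Y r) (X r) := Bhom (@page_inv_d r).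

Lemma page_inv_phi r p n (y : Y r.+1 p n) :
  phi X r p n (page_inv r.+1 p n y) = homology_map (page_inv r) p n
    (phi Y r p n y).
Proof.
rewrite -{2}[y](lin_invKV (f_bij r.+1 p n)) sfun_phi -homology_map_comp.
have [x xk ->] := coset_class_surj (phi X r p n (page_inv r.+1 p n y)).
rewrite (homology_mapE _ xk); apply: (congr1 (@hclass R r (X r) p n)).
exact/esym/lin_invK.
Qed.

Lemma pagewise_iso : spse_iso f.
Proof.
exists (SpSeHom page_inv_phi); split=> r p n x; first exact: lin_invK.
exact: lin_invKV.
Qed.

End PagewiseIso.

(** * Naturality *)

Section Naturality.
Variables (R : comPzRingType) (C D : filcx R) (f : filhom C D).

Lemma Emap_eclass r p q m (e : m = q - p) z : z \in Zc C r p m ->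
  Emap f r p q (eclass r e z) = eclass r e (f m z).
Proof. by subst m => zZ; rewrite /eclass !ccast_id [LHS]Emap_linE. Qed.

Lemma nmap_nclass s t m (e : m = t - s) z : z \in Zc C 1 s m ->
  nmap (spseE_hom f) s t (nclass e z) = nclass e (f m z).
Proof.
move=> zZ; apply: val_inj; rewrite val_nclass ?ffun_Z //.
rewrite [LHS]/= /nmap_fun val_nclass // /nclass_raw -ffun_d.
congr ((_, _), (_, _)); apply: Emap_eclass => //.
- exact: Zc_succ.
- exact: nclass_dZ.
- exact: nclass_dZ.
Qed.

Lemma dec_fun_dclass r p q m (e : m = q - p) (z : C m) :
    z \in Zc (dec_filcx C) r p m ->
  dec_fun (spseE_hom f) r p q (dclass r e z) = dclass r e (f m z).
Proof.
rewrite (dec_Zc (C := C) _ _ (dclass_s e)); case: r => [|i] zZ.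
  exact: nmap_nclass.
exact: Emap_eclass.
Qed.

End Naturality.

Theorem proposition6p4p2 (R : comPzRingType) :
  exists eta : forall C : filcx R,
      spse_hom (spseE (dec_filcx C)) (dec_spse (spseE C)),
    (forall C : filcx R, spse_iso (eta C)) /\
    (forall (C D : filcx R) (f : filhom C D),
       spse_hom_eq
         (spse_comp (dec_spse_hom (spseE_hom f)) (eta C))
         (spse_comp (eta D) (spseE_hom (dec_filhom f)))).
Proof.
exists (@dec_comparison R); split=> [C|C D f r p q x].
  by apply: pagewise_iso; exact: dec_comparison_lin_bij.
have [z zZ ->] := eclass_surj (C := dec_filcx C) erefl x.
have fzZ := ffun_Z (dec_filhom f) zZ.
change (dec_fun (spseE_hom f) r p q
    (dec_comparison_lin C r p q (eclass (C := dec_filcx C) r erefl z)) =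
  dec_comparison_lin D r p q
    (Emap (dec_filhom f) r p q (eclass (C := dec_filcx C) r erefl z))).
have -> : Emap (dec_filhom f) r p q (eclass (C := dec_filcx C) r erefl z) =
    eclass (C := dec_filcx D) r erefl (dec_filhom f (q - p) z).
  exact: Emap_eclass.
rewrite (dec_comparison_linE erefl zZ) (dec_comparison_linE erefl fzZ).
exact: dec_fun_dclass.
Qed.
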